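(* Let $(G,+)$ be an abelian group and let $A$ be a finite subset of $G\setminus\{0\}$ with $|A|\leq 8$, such that no $2$-subset of the form $\{x,-x\}$ (with $x\neq -x$) is contained in $A$, and such that $\sum_{a\in A}a=0$. Then there exists an ordering $(a_1,a_2,\ldots,a_k)$ of the elements of $A$ (where $k=|A|$) whose partial sums $s_j=\sum_{i=1}^{j}a_i$, $1\leq j\leq k$, are pairwise distinct.
   Context: For an ordering $(a_1,\ldots,a_k)$ of a finite subset $A$ of a group, the partial sums are $s_j=a_1+\cdots+a_j$ for $1\leq j\leq k$. An ordering is called simple if all its partial sums are distinct. *)

(* Defs.v *)
From HB Require Import structures.
From mathcomp Require Import all_boot all_order all_algebra finmap.

Set Implicit Arguments.
Unset Strict Implicit.
Unset Printing Implicit Defensive.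

Import GRing.Theory.
Local Open Scope ring_scope.
Local Open Scope fset_scope.

Definition is_ordering (G : zmodType) (A : {fset G}) (s : seq G) : Prop :=
  perm_eq s (enum_fset A).

Definition partial_sum (G : zmodType) (s : seq G) (j : nat) : G :=
  \sum_(0 <= i < j) s`_i.

(* [s_1; ...; s_k], where k is the length of s; the empty sum s_0 = 0 is not
   included, so one of the s_j may be 0. *)
Definition partial_sums (G : zmodType) (s : seq G) : seq G :=
  [seq partial_sum s j | j <- iota 1 (size s)].

Definition simple_ordering (G : zmodType) (A : {fset G}) (s : seq G) : Prop :=
  is_ordering A s /\ uniq (partial_sums s).

(* Main.v *)
Require Import Defs.
From HB Require Import structures.
From mathcomp Require Import all_boot all_order all_algebra finmap.

(** Encode a subset of A by its indicator word in {0,1}^k.  If two distinct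
    words of Hamming distance at most 2 both had zero sum, then subtracting
    would give x = 0, x = y or x = -y for some distinct x, y in A, which is
    excluded.  Hence the zero-sum words form a code of minimum distance at
    least 3, closed under complement since A sums to zero.  An ordering of A is
    simple iff no block of consecutive elements avoiding the first one is a
    codeword.  For k <= 8, no such code meets all orderings: go through the
    orderings in turn, branch on the block that is a codeword, and drop the
    branches in which two codewords come too close. *)

Set Implicit Arguments.
Unset Strict Implicit.
Unset Printing Implicit Defensive.

Import GRing.Theory.
Local Open Scope ring_scope.

Definition hamming (u v : bitseq) : nat :=
  count (fun b => b.1 (+) b.2) (zip u v).

(** The sum over an arc is s_j - s_i. The index [i] starts at 1 because the empty sum s_0 is not
    compared, and stays below [j], so arcs are nonempty. *)
Definition arcs (p : seq nat) : seq (seq nat) :=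
  [seq drop i (take j p) | j <- iota 0 (size p).+1, i <- iota 1 j.-1].

(** Positions refer to a fixed enumeration of A, so words coming from different orderings are
    comparable. *)
Definition indicator (n : nat) (u : seq nat) : bitseq :=
  [seq i \in u | i <- iota 0 n].

Definition arc_words (p : seq nat) : seq bitseq :=
  [seq indicator (size p) u | u <- arcs p].

(* [Z] collects the words assumed to be codewords. The nested [if] is not
   written [||], which would evaluate the recursive call under [vm_compute]
   even in the branches already closed. *)
Fixpoint refutes (Z : seq bitseq) (Ws : seq (seq bitseq)) : bool :=
  if Ws is W :: Ws' then
    if has (fun u => u \in Z) W then refutes Z Ws'
    else all (fun u =>
           if has (fun z => 0 < hamming u z <= 2)%N Z then true
           else refutes [:: u, map negb u & Z] Ws') W
  else false.

(* [permutations] lists first the orderings with a fixed last element; up to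
   rotation these are all the orderings. *)
Definition orderings (n : nat) : seq (seq nat) :=
  take n.-1`! (permutations (iota 0 n)).

Definition search (n : nat) : bool :=
  refutes [:: nseq n false; nseq n true] (map arc_words (orderings n)).

Lemma search_le8 n : (n <= 8)%N -> search n.
Proof.
have : all search (iota 0 9) by vm_cast_no_check (erefl true).
by move=> /allP searchP n_le; apply: searchP; rewrite mem_iota.
Qed.

Section WordSums.
Variable G : zmodType.
Implicit Types (s : seq G) (u v w : bitseq).

Definition wsum s w : G := \sum_(x <- mask w s) x.

Lemma wsum_cons x s b w : wsum (x :: s) (b :: w) = x *+ b + wsum s w.
Proof. by case: b; rewrite /wsum /= ?big_cons ?mulr1n ?add0r. Qed.

Lemma wsum_compl s w : size w = size s ->
  wsum s w + wsum s (map negb w) = \sum_(x <- s) x.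
Proof.
elim: s w => [|x s IHs] [|b w] //=; first by rewrite /wsum /= !big_nil addr0.
case=> /IHs {}IHs; rewrite !wsum_cons big_cons -IHs.
by case: b; rewrite /= add0r; [rewrite -addrA | rewrite addrCA].
Qed.

Lemma hammingC u v : hamming u v = hamming v u.
Proof.
by rewrite /hamming; elim: u v => [|b u IHu] [|c v] //=; rewrite addbC IHu.
Qed.

Lemma hamming0_eq u v : size u = size v -> hamming u v = 0%N -> u = v.
Proof.
elim: u v => [|b u IHu] [|c v] //= [/IHu {}IHu].
by rewrite /hamming /=; case: b c => [] [] //= /IHu ->.
Qed.

Lemma hamming1_wsum s u v : size u = size s -> size v = size s ->
  hamming u v = 1%N ->
  exists2 x, x \in s & wsum s u = wsum s v + x \/ wsum s v = wsum s u + x.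
Proof.
elim: s u v => [|x s IHs] [|b u] [|c v] //= [su] [sv].
rewrite /hamming /= !wsum_cons; have [->|neq_bc] := eqVneq b c.
  rewrite addbb add0n => /(IHs _ _ su sv) [y ys eq_uv].
  by exists y; [rewrite inE ys orbT | case: eq_uv => ->; rewrite addrA; [left|right]].
have -> : b (+) c by case: b c neq_bc => [] [].
case=> /hamming0_eq ->; last by rewrite su.
exists x; first exact: mem_head.
by case: b c neq_bc => [] [] // _; rewrite add0r [x *+ _ + _]addrC; [left|right].
Qed.

(** Common letters cancel up to the first difference, at x. The tails then differ nowhere, giving x
    = 0, or only at some y, giving x = y or x + y = 0. *)
Lemma wsum_close_neq s u v :
    0 \notin s -> pairwise (fun x y => (x != y) && (x + y != 0)) s ->
    size u = size s -> size v = size s -> (0 < hamming u v <= 2)%N ->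
  wsum s u <> wsum s v.
Proof.
elim: s u v => [|x s IHs] [|b u] [|c v] //=.
rewrite inE negb_or => /andP[x_neq0 s_neq0] /andP[/allP xs s_pw] [su] [sv].
rewrite /hamming /= !wsum_cons; have [->|neq_bc] := eqVneq b c.
  by rewrite addbb add0n -/(hamming u v) => d_uv /addrI; apply: IHs.
have -> : b (+) c by case: b c neq_bc => [] [].
rewrite add1n /= ltnS -/(hamming u v) => d_uv.
wlog [-> ->] : b c u v su sv d_uv {neq_bc} / b = true /\ c = false.
  move=> wl; case: b c neq_bc => [] [] // _; first exact: (wl true false).
  by move/esym; apply: (wl true false); rewrite // hammingC.
rewrite mulr1n add0r; move: d_uv; rewrite leq_eqVlt ltnS leqn0 => /orP[]/eqP h.
  have [y /xs /andP[x_neqy xy_neq0] uv] := hamming1_wsum su sv h.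
  case: uv => ->; last by rewrite addrC => /addrI/eqP; apply/negP.
  by rewrite addrCA -[RHS]addr0 => /addrI/eqP; apply/negP.
rewrite (hamming0_eq _ h) ?su // -[RHS]add0r => /addIr/eqP.
by rewrite eq_sym; apply/negP.
Qed.

(** The words that really have zero sum trace a path in the search tree along which [Z] holds only
    such words. The path cannot enter a closed branch, so it stops at a list [W] free of them. *)
Lemma refutes_sound s (Z : seq bitseq) (Ws : seq (seq bitseq)) :
    0 \notin s -> pairwise (fun x y => (x != y) && (x + y != 0)) s ->
    \sum_(x <- s) x = 0 ->
    {in Z, forall z, size z = size s /\ wsum s z = 0} ->
    {in Ws, forall W, {in W, forall w, size w = size s}} ->
    refutes Z Ws ->
  exists2 W, W \in Ws & {in W, forall w, wsum s w != 0}.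
Proof.
move=> s_neq0 s_pw s_sum0; elim: Ws Z => [|W Ws IHWs] Z //= Z0 sWs.
have {}IHWs Z' : {in Z', forall z, size z = size s /\ wsum s z = 0} ->
    refutes Z' Ws -> exists2 W0, W0 \in W :: Ws & {in W0, forall w, wsum s w != 0}.
  move=> Z'0 /(IHWs _ Z'0) [|W' W'Ws W'0].
    by move=> W' W'Ws; apply: sWs; rewrite inE W'Ws orbT.
  by exists W'; rewrite // inE W'Ws orbT.
case: ifP => _; first exact: IHWs.
case: (boolP (all (fun w => wsum s w != 0) W)) => [/allP W0 _|].
  by exists W; first exact: mem_head.
case/allPn=> w wW; rewrite negbK => /eqP w0 /allP /(_ w wW).
have sw : size w = size s by apply: (sWs W) => //; exact: mem_head.
case: ifP => [/hasP[z /Z0[sz z0] d_wz] _|_].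
  by case: (wsum_close_neq s_neq0 s_pw sw sz d_wz); rewrite w0 z0.
apply: IHWs => z; rewrite !inE => /or3P[/eqP->|/eqP->|/Z0] //.
by rewrite size_map; split=> //; have := wsum_compl sw; rewrite w0 s_sum0 add0r.
Qed.

Lemma wsum_indicator s (u : seq nat) : uniq u -> {subset u <= iota 0 (size s)} ->
  wsum s (indicator (size s) u) = \sum_(i <- u) s`_i.
Proof.
move=> u_uniq u_sub; rewrite /wsum -{2}[s](mkseq_nth 0) /mkseq -map_mask.
(* The mask reads the positions of [u] in increasing order, so the two sums differ only in the order
   of their terms. *)
rewrite -filter_mask big_map; apply: perm_big; apply: uniq_perm => //.
  exact/filter_uniq/iota_uniq.
by move=> i; rewrite mem_filter; case: (boolP (i \in u)) => //= /u_sub ->.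
Qed.

Lemma partial_sum_arc s i j : (i <= j <= size s)%N ->
  partial_sum s j = partial_sum s i + \sum_(x <- drop i (take j s)) x.
Proof.
case/andP=> ij js; rewrite /partial_sum (big_cat_nat (n := i)) //=.
congr (_ + _); rewrite [RHS](big_nth 0) size_drop size_takel //.
rewrite -{1}[i]add0n big_addn; apply: eq_big_nat => k /andP[_ kj].
by rewrite nth_drop nth_take ?[(k + i)%N]addnC // -ltn_subRL.
Qed.

End WordSums.

Local Open Scope fset_scope.

Theorem theorem4p1 (G : zmodType) (A : {fset G})
  (A_nz : 0 \notin A)
  (A_card : (#|` A| <= 8)%N)
  (A_noopp : forall x : G, x != - x -> ~~ ([fset x; - x] `<=` A))
  (A_sum0 : \sum_(a <- A) a = 0) :
  exists s : seq G, simple_ordering A s.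
Proof.
set s := enum_fset A; set n := size s.
have s_uniq : uniq s := fset_uniq A.
have s_pw : pairwise (fun x y => (x != y) && (x + y != 0)%R) s.
  apply: (@sub_in_pairwise _ (mem s) (fun x y => x != y)); first last.
  - by rewrite -uniq_pairwise.
  - exact/allP.
  move=> x y xs ys x_neqy; rewrite x_neqy /=; apply/negP.
  (* With y = -x, the hypothesis x != y becomes x != -x, so x = -x is no obstacle. *)
  rewrite addrC addr_eq0 => /eqP y_opp.
  have := A_noopp x; rewrite -y_opp => /(_ x_neqy)/negP; apply.
  by apply/fsubsetP=> z; rewrite !inE => /orP[] /eqP->.
have orderP p : p \in orderings n -> perm_eq p (iota 0 n).
  by move/mem_take; rewrite mem_permutations.
have arcP p u : p \in orderings n -> u \in arcs p ->
    uniq u /\ {subset u <= iota 0 n}.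
  move=> /orderP p_iota /allpairsPdep[j [i [_ _ ->]]]; split.
    by rewrite drop_uniq // take_uniq // (perm_uniq p_iota) iota_uniq.
  by move=> k /mem_drop/mem_take; rewrite (perm_mem p_iota).
have sizeP p : p \in orderings n -> size p = n.
  by move/orderP/perm_size->; rewrite size_iota.
(* The two initial codewords stand for the empty set and for A itself; [p] orders the positions so
   that no arc has zero sum. *)
have [||W /mapP[p p_ord ->{W}] p0] :=
  refutes_sound A_nz s_pw A_sum0 _ _ (search_le8 A_card).
- move=> z; rewrite !inE => /orP[]/eqP->; rewrite size_nseq; split=> //.
    by rewrite /wsum mask_false big_nil.
  by rewrite /wsum mask_true.
- move=> _ /mapP[p p_ord ->] _ /mapP[u _ ->].
  by rewrite size_map size_iota; apply: sizeP.
exists [seq s`_i | i <- p]; split.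
  by rewrite /is_ordering -[enum_fset A](mkseq_nth 0) perm_map // orderP.
have sp := sizeP p p_ord.
rewrite /partial_sums map_inj_in_uniq ?iota_uniq // size_map => i j.
rewrite !mem_iota !add1n !ltnS.
wlog lt_ij : i j / (i < j)%N.
  by case: (ltngtP i j) => // ij wl ir jr /esym eq_ij; [apply: wl|symmetry; apply: wl].
move=> /andP[i_gt0 _] /andP[j_gt0 j_le].
(* Equality of s_i and s_j makes the block between them sum to zero; as i > 0, this block is an arc
   of [p]. *)
rewrite (@partial_sum_arc _ _ i j) ?size_map ?(ltnW lt_ij) //.
rewrite -[LHS]addr0 => /addrI/esym.
rewrite -map_take -map_drop big_map => arc0.
have arc_in : drop i (take j p) \in arcs p.
  apply/allpairsPdep; exists j, i; split=> //; rewrite mem_iota ?ltnS //.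
  by rewrite i_gt0 -ltnS prednK.
have [u_uniq u_sub] := arcP _ _ p_ord arc_in.
have := p0 _ (map_f (indicator (size p)) arc_in).
by rewrite sp wsum_indicator // arc0 eqxx.
Qed.
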